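(* Let $\mathbf{A}\in\mathbb{R}^{m\times n}$ and $\mathbf{b}\in\mathbb{R}^m$ be such that $\mathbf{A}\mathbf{x}=\mathbf{b}$ is consistent, and let $\mathbf{x}_\star=\mathbf{A}^\dagger\mathbf{b}$ be its least-norm solution. Then the iterative sequence $\{\mathbf{x}_k\}$ generated by the RPLSS-GK algorithm (described in the context) with parameter $0<l<1$ converges to $\mathbf{x}_\star$ for any initial vector $\mathbf{x}_0\in\mathcal{R}(\mathbf{A}^T)$. Moreover, the corresponding error norm in expectation satisfies $$\mathbb{E}_k\|\mathbf{x}_k-\mathbf{x}_\star\|_2^2\le\left(1-\frac{l\,\lambda_{min}^2(\mathbf{A}^T\mathbf{A})}{\sin^2(\theta_{k-1})\,\lambda_{max}^2(\mathbf{A}^T\mathbf{A})}\right)\|\mathbf{x}_{k-1}-\mathbf{x}_\star\|_2^2,$$ where $\theta_{k-1}$ is the angle between the vector $\mathbf{A}^T\mathbf{s}_k$ and the column space of $\mathbf{P}_{k-1}$.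
   Context: $\mathcal{R}(\cdot)$ denotes column space; $\lambda_{min}(\cdot)$ the minimal nonzero eigenvalue and $\lambda_{max}(\cdot)$ the maximal eigenvalue; $\mathbf{A}^\dagger$ the Moore-Penrose pseudo-inverse; $\mathbf{e}_i$ the $i$-th column of the identity. $\mathbb{E}_k$ denotes expectation conditional on the index sets chosen in the iterations before the one producing $\mathbf{x}_k$ (i.e. conditional on $\tau_1,\dots,\tau_{k-1}$). RPLSS-GK algorithm (with weight $\mathbf{W}=\mathbf{I}$). Fix $0<l<1$ and an initial vector $\mathbf{x}_0$. For $k=1,2,\dots$: (i) choose an index set $\tau_k\subseteq\{1,\dots,m\}$ of $lm$ rows by simple random sampling (uniform, without replacement); (ii) with $\mathbf{r}_{k-1}=\mathbf{b}-\mathbf{A}\mathbf{x}_{k-1}$, set $\mathbf{s}_k=\sum_{i\in\tau_k}\mathbf{r}_{k-1}^{(i)}\mathbf{e}_i$; (iii) with $\mathbf{P}_{k-1}=[\mathbf{p}_1,\dots,\mathbf{p}_{k-1}]$ ($\mathbf{P}_0$ empty, all terms containing it being zero), $\mathbf{\Theta}_{k-1}=\mathbf{P}_{k-1}^T\mathbf{P}_{k-1}$ (diagonal), $\mathbf{d}_{k-1}=\mathbf{\Theta}_{k-1}^{-1/2}\mathbf{P}_{k-1}^T\mathbf{A}^T\mathbf{s}_k$ and $\gamma_{k-1}=\dfrac{\mathbf{s}_k^T(\mathbf{b}-\mathbf{A}\mathbf{x}_{k-1})}{\|\mathbf{A}^T\mathbf{s}_k\|_2^2-\|\mathbf{d}_{k-1}\|_2^2}$,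 compute $\mathbf{p}_k=\gamma_{k-1}\left(\mathbf{A}^T\mathbf{s}_k-\mathbf{P}_{k-1}\mathbf{\Theta}_{k-1}^{-1}\mathbf{P}_{k-1}^T\mathbf{A}^T\mathbf{s}_k\right)$; (iv) set $\mathbf{x}_k=\mathbf{x}_{k-1}+\mathbf{p}_k$. The formulas are understood for steps at which the inverses exist and the denominators are nonzero. The angle $\theta_{k-1}$ satisfies $\|\mathbf{A}^T\mathbf{s}_k\|_2^2-\|\mathbf{d}_{k-1}\|_2^2=\sin^2(\theta_{k-1})\|\mathbf{A}^T\mathbf{s}_k\|_2^2$.
   Formalization: The stated inequality fails if θ_{k-1} is the angle of the actual draw s_k; it is proved with θ_{k-1} the largest angle over all possible draws of lm rows with A^T s_k ≠ 0. Convergence is almost sure, and draws where the formulas are undefined leave x_k and P_k unchanged. *)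

(* Defs.v *)
From HB Require Import structures.
From mathcomp Require Import all_boot all_order all_algebra.
From mathcomp Require Import all_classical all_reals all_analysis.

Set Implicit Arguments.
Unset Strict Implicit.
Unset Printing Implicit Defensive.

Import Order.TTheory GRing.Theory Num.Theory.
Import numFieldNormedType.Exports.

Local Open Scope classical_set_scope.
Local Open Scope ring_scope.

Section LinearAlgebra.
Context {R : realType}.

Definition dotv n (u v : 'cV[R]_n) : R := (u^T *m v) 0 0.

Definition norm2 n (v : 'cV[R]_n) : R := Num.sqrt (dotv v v).

Definition is_pinv m n (A : 'M[R]_(m, n)) (X : 'M[R]_(n, m)) : Prop :=
  [/\ A *m X *m A = A, X *m A *m X = X,
      (A *m X)^T = A *m X & (X *m A)^T = X *m A].

Definition min_nonzero_eigenvalue n (M : 'M[R]_n) (a : R) : Prop :=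
  [/\ eigenvalue M a, a != 0 &
      forall c, eigenvalue M c -> c != 0 -> a <= c].

Definition max_eigenvalue n (M : 'M[R]_n) (a : R) : Prop :=
  eigenvalue M a /\ forall c, eigenvalue M c -> c <= a.

(* The matrix whose columns are, in this order, the vectors of [ps]. *)
Definition cols_mx n (ps : seq 'cV[R]_n) : 'M[R]_(n, size ps) :=
  \matrix_(i, j) (ps`_j) i 0.

(* Orthogonal projector onto the column space of P, for P of full column rank
   (it is 0 when P has no column). *)
Definition col_proj n k (P : 'M[R]_(n, k)) : 'M[R]_n :=
  P *m invmx (P^T *m P) *m P^T.

(* Angle in [0, pi/2] between v != 0 and the column space of P; it is pi/2
   when P has no column. *)
Definition angle_cols n k (v : 'cV[R]_n) (P : 'M[R]_(n, k)) : R :=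
  acos (norm2 (col_proj P *m v) / norm2 v).

End LinearAlgebra.

Section Algorithm.
Context {R : realType}.
Variables (m n : nat) (A : 'M[R]_(m, n)) (b : 'cV[R]_m).

(* Current iterate x together with the list p_1, p_2, ... of the directions
   computed so far. *)
Definition gk_state := ('cV[R]_n * seq 'cV[R]_n)%type.

Definition gk_sketch (st : gk_state) (t : {set 'I_m}) : 'cV[R]_m :=
  \sum_(i in t) (b - A *m st.1) i 0 *: delta_mx i 0.

Definition gk_Theta (ps : seq 'cV[R]_n) : 'M[R]_(size ps) :=
  (cols_mx ps)^T *m cols_mx ps.

(* Theta is diagonal, hence the entrywise Theta^(-1/2). *)
Definition gk_d (ps : seq 'cV[R]_n) (s : 'cV[R]_m) : 'cV[R]_(size ps) :=
  diag_mx (\row_j (Num.sqrt (gk_Theta ps j j))^-1)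
    *m (cols_mx ps)^T *m A^T *m s.

Definition gk_denom (ps : seq 'cV[R]_n) (s : 'cV[R]_m) : R :=
  norm2 (A^T *m s) ^+ 2 - norm2 (gk_d ps s) ^+ 2.

Definition gk_gamma (st : gk_state) (s : 'cV[R]_m) : R :=
  dotv s (b - A *m st.1) / gk_denom st.2 s.

Definition gk_direction (st : gk_state) (s : 'cV[R]_m) : 'cV[R]_n :=
  let P := cols_mx st.2 in
  gk_gamma st s *:
    (A^T *m s - P *m invmx (gk_Theta st.2) *m P^T *m A^T *m s).

(* When the formulas are undefined (Theta singular or zero denominator, e.g.
   because the sampled residual entries all vanish) the draw is discarded:
   neither the iterate nor the list of directions changes. *)
Definition gk_step (st : gk_state) (t : {set 'I_m}) : gk_state :=
  let s := gk_sketch st t in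
  if (gk_Theta st.2 \in unitmx) && (gk_denom st.2 s != 0) then
    let p := gk_direction st s in (st.1 + p, rcons st.2 p)
  else st.

(* State after k draws; the draw producing the iterate k.+1 is [t k]. *)
Fixpoint gk_run (x0 : 'cV[R]_n) (t : nat -> {set 'I_m}) (k : nat) : gk_state :=
  if k is k'.+1 then gk_step (gk_run x0 t k') (t k') else (x0, [::]).

Definition gk_iter x0 t k : 'cV[R]_n := (gk_run x0 t k).1.

(* The angle between A^T s and the column space of P depends on the draw of
   the next index set through s.  This is its largest value over all draws of
   q rows for which it is defined, a quantity that, like the conditional
   expectation it is compared with, depends on the previous draws only. *)
Definition gk_theta (q : nat) (st : gk_state) : R :=
  \big[Num.max/0]_(t : {set 'I_m} |
      (#|t| == q) && (A^T *m gk_sketch st t != 0))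
    angle_cols (A^T *m gk_sketch st t) (cols_mx st.2).

End Algorithm.

Section Sampling.
Context {R : realType} {d : measure_display} {T : measurableType d}.
Variable P : probability T R.

(* tau_0, tau_1, ... are mutually independent, each uniform on the subsets of
   size q of 'I_m. *)
Definition simple_random_samples m (q : nat) (tau : nat -> T -> {set 'I_m}) :
    Prop :=
  [/\ forall i t, measurable [set w | tau i w = t],
      forall i t, P [set w | tau i w = t] =
        (if #|t| == q then ('C(m, q)%:R)^-1 else 0 : R)%:E &
      forall (J : seq nat) (B : nat -> {set {set 'I_m}}), uniq J ->
        P [set w | forall i, i \in J -> tau i w \in B i] =
        (\prod_(i <- J) P [set w | tau i w \in B i])%E].

(* The event that the first k draws are t 0, ..., t k.-1. *)
Definition history m (tau : nat -> T -> {set 'I_m}) (k : nat)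
    (t : nat -> {set 'I_m}) : set T :=
  [set w | forall i, (i < k)%N -> tau i w = t i].

(* Conditional expectation given an event H of positive probability. *)
Definition cond_expect (X : T -> R) (H : set T) : R :=
  Rintegral P H X / fine (P H).

End Sampling.

(* Main.v *)
Require Import Defs.
From HB Require Import structures.
From mathcomp Require Import all_boot all_order all_algebra.
From mathcomp Require Import all_classical all_reals all_analysis.
From mathcomp Require Import spectral complex measurable_realfun ring lra.

(** Write e = x - xstar for the error of the current iterate, s for the
sketched residual, v = A^T s, and u for the component of v orthogonal to the
directions p_1, p_2, ... computed so far.

A step is an orthogonal projection.  The new direction is a multiple of u, and
the denominator of gamma is |u|^2 ([gk_denomE]).  Since A xstar = b, the
residual is - A e, and since s is a restriction of the residual,
<v, e> = - <s, b - A x> = - |s|^2.  The error stays orthogonal to all former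
directions, so that also <u, e> = - |s|^2, and the step replaces e by
e - (<u, e> / |u|^2) u ([gk_stepE]).  Hence
   |e_k|^2 = |e_(k-1)|^2 - |s|^4 / |u|^2       ([sqr_error_step]).
In particular a draw is discarded exactly when s = 0 ([reduced_dir_eq0]).

Almost sure convergence, by finite termination.  The directions are nonzero
and pairwise orthogonal in R^n, so at most n draws are effective.  Almost
surely each row index is drawn infinitely often ([ae_every_row_recurs]); then
as long as the residual has a nonzero entry, another effective draw will come.
So after finitely many steps the residual vanishes, and so does the error,
which lies in the range of A^T, where A is injective ([gk_run_terminates]).

Rate.  By the choice of the angle theta, |u|^2 <= sin^2 theta |v|^2, and
|v|^2 <= lmax |s|^2; the decrease |s|^4 / |u|^2 is therefore at least
|s|^2 / (sin^2 theta lmax) ([sqr_error_step_theta]).  Each row belongs to a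
draw with probability q / m = l, so |s|^2 has mean l |A e|^2, and
|A e|^2 >= lmin |e|^2 because e is in the range of A^T.  This yields the
contraction factor 1 - l lmin / (sin^2 theta lmax), which is at most the
claimed one since lmin <= lmax ([expected_sqr_error_step]).  Conditioning on a
history leaves the law of the next draw unchanged by independence
([cond_expect_next]).

Both eigenvalue bounds come from the spectral theorem in the form of
[spectral_measure]: the moments <v, M^k v> of a real symmetric M are those of
a nonnegative measure on the eigenvalues of M. *)

Set Implicit Arguments.
Unset Strict Implicit.
Unset Printing Implicit Defensive.

Import Order.TTheory GRing.Theory Num.Theory.
Import numFieldNormedType.Exports.

Local Open Scope classical_set_scope.
Local Open Scope ring_scope.

(** * Spectral measures of real symmetric matrices *)

Section SpectralMeasure.
Context {R : realType}.
Local Open Scope sesquilinear_scope.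
Local Notation toC := (real_complex R).

(** The matrix M, seen over the complex numbers, is U^-1 D U with U unitary and
D real diagonal; the weight at the i-th eigenvalue is the squared modulus of
the i-th coordinate of U v.  Only real eigenvalues and real weights remain in
the statement, so no complex number appears outside this proof. *)
Lemma spectral_measure n (M : 'M[R]_n) (v : 'cV[R]_n) : M^T = M ->
  exists c a : 'I_n -> R,
    [/\ forall i, eigenvalue M (c i), forall i, 0 <= a i &
        forall k, dotv v (iter k (mulmx M) v) = \sum_i c i ^+ k * a i].
Proof.
move=> Msym; pose MC := map_mx toC M; pose vC := map_mx toC v.
have realC k l (X : 'M[R]_(k, l)) : map_mx toC X \is a mxOver Num.real.
  by apply/mxOverP => i j; rewrite mxE; apply/complex_realP; exists (X i j).
have MCherm : MC \is hermsymmx.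
  apply/is_hermitianmxP.
  by rewrite expr0 scale1r realmxC /MC map_trmx ?realC // Msym.
pose U := spectralmx MC; pose D := spectral_diag MC.
have Uu : U \is unitarymx by exact: spectral_unitarymx.
have Uunit := unitarymx_unit Uu.
have ME : MC = invmx U *m diag_mx D *m U.
  exact/orthomx_spectralP/hermitian_normalmx.
have UM : U *m MC = diag_mx D *m U by rewrite ME !mulmxA mulmxV // mul1mx.
have Dreal i : {c : R | D 0 i = toC c}.
  have /mxOverP/(_ 0 i)/complex_realP := hermitian_spectral_diag_real MCherm.
  by move=> /cid.
pose c i := projT1 (Dreal i); have DE i : D 0 i = toC (c i) := projT2 (Dreal i).
pose y := U *m vC.
pose a i := complex.Re (`|y i 0| ^+ 2).
have aE i : toC (a i) = `|y i 0| ^+ 2.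
  by apply: RRe_real; rewrite realE exprn_ge0.
exists c, a; split=> [i|i|k].
- rewrite eigenvalue_root_char -(fmorph_root toC) /= map_char_poly.
  rewrite -eigenvalue_root_char -DE; apply/eigenvalueP; exists (row i U).
    by rewrite -row_mul UM row_mul row_diag_mx -scalemxAl -rowE.
  (* A row of an invertible matrix is not zero. *)
  apply: contraTneq isT => Ui0.
  have : row i U *m invmx U = 0 by rewrite Ui0 mul0mx.
  rewrite -row_mul mulmxV // row1 => /rowP/(_ i).
  by rewrite !mxE !eqxx => /eqP; rewrite oner_eq0.
- by rewrite -ler0c aE exprn_ge0.
- apply: (@complexI R).
  have itE : U *m map_mx toC (iter k (mulmx M) v) =
             \col_i (toC (c i) ^+ k * y i 0).
    elim: k => [|k IH] /=.
      by apply/colP => i; rewrite mxE expr0 mul1r.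
    rewrite map_mxM mulmxA -/MC UM -mulmxA IH.
    by apply/colP => i; rewrite mul_diag_mx !mxE DE exprS mulrA.
  have -> : toC (dotv v (iter k (mulmx M) v)) =
     ((U *m vC)^t* *m (U *m map_mx toC (iter k (mulmx M) v))) 0 0.
    rewrite trmx_mul map_mxM -mulmxA (mulmxA _ U) -invmx_unitary // mulVmx //.
    rewrite mul1mx map_trmx (realmxC (realC _ _ v^T)) /dotv.
    by rewrite -map_mxM [RHS]mxE.
  rewrite itE mxE rmorph_sum; apply: eq_bigr => i _.
  by rewrite rmorphM rmorphXn /= aE normCK !mxE; ring.
Qed.
End SpectralMeasure.

(** * Inner products, Gram matrices and projections *)

Section InnerProduct.
Context {R : realType}.

Lemma dotvE n (u v : 'cV[R]_n) : dotv u v = \sum_i u i 0 * v i 0.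
Proof. by rewrite /dotv mxE; apply: eq_bigr => i _; rewrite mxE. Qed.

Lemma dotvC n (u v : 'cV[R]_n) : dotv u v = dotv v u.
Proof. by rewrite !dotvE; apply: eq_bigr => i _; rewrite mulrC. Qed.

Lemma dotvDr n (u v w : 'cV[R]_n) : dotv u (v + w) = dotv u v + dotv u w.
Proof. by rewrite /dotv mulmxDr mxE. Qed.

Lemma dotvNr n (u v : 'cV[R]_n) : dotv u (- v) = - dotv u v.
Proof. by rewrite /dotv mulmxN mxE. Qed.

Lemma dotvZr n a (u v : 'cV[R]_n) : dotv u (a *: v) = a * dotv u v.
Proof. by rewrite /dotv -scalemxAr mxE. Qed.

Lemma dotv0r n (u : 'cV[R]_n) : dotv u 0 = 0.
Proof. by rewrite /dotv mulmx0 mxE. Qed.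

Lemma dotvDl n (u v w : 'cV[R]_n) : dotv (u + v) w = dotv u w + dotv v w.
Proof. by rewrite !(dotvC _ w) dotvDr. Qed.

Lemma dotvNl n (u v : 'cV[R]_n) : dotv (- u) v = - dotv u v.
Proof. by rewrite !(dotvC _ v) dotvNr. Qed.

Lemma dotvZl n a (u v : 'cV[R]_n) : dotv (a *: u) v = a * dotv u v.
Proof. by rewrite !(dotvC _ v) dotvZr. Qed.

Definition dotv_linE := (dotvDl, dotvDr, dotvNl, dotvNr, dotvZl, dotvZr).

Lemma dotv_mulmxr m n (A : 'M[R]_(m, n)) u v :
  dotv u (A *m v) = dotv (A^T *m u) v.
Proof. by rewrite /dotv trmx_mul trmxK mulmxA. Qed.

Lemma dotv_ge0 n (v : 'cV[R]_n) : 0 <= dotv v v.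
Proof. by rewrite dotvE sumr_ge0 // => i _; rewrite -expr2 sqr_ge0. Qed.

Lemma dotv_eq0 n (v : 'cV[R]_n) : (dotv v v == 0) = (v == 0).
Proof.
apply/eqP/eqP => [|->]; last exact: dotv0r.
rewrite dotvE => /eqP; rewrite psumr_eq0 => [/allP v0|i _]; last first.
  by rewrite -expr2 sqr_ge0.
apply/colP => i; rewrite mxE; apply/eqP.
by have := v0 i (mem_index_enum i); rewrite mulf_eq0 orbb.
Qed.

Lemma sqr_norm2 n (v : 'cV[R]_n) : norm2 v ^+ 2 = dotv v v.
Proof. by rewrite sqr_sqrtr // dotv_ge0. Qed.

End InnerProduct.

Section GramSpectrum.
Context {R : realType} {m n : nat} (A : 'M[R]_(m, n)).
Local Notation M := (A^T *m A).

Lemma gram_sym : M^T = M.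
Proof. by rewrite trmx_mul trmxK. Qed.

Lemma dotv_gram (u v : 'cV[R]_n) : dotv u (M *m v) = dotv (A *m u) (A *m v).
Proof. by rewrite -mulmxA dotv_mulmxr trmxK. Qed.

Lemma gram_eigenvalue_ge0 c : eigenvalue M c -> 0 <= c.
Proof.
move=> /eigenvalueP[w wM w0].
have vM : M *m w^T = c *: w^T by rewrite -{1}gram_sym -trmx_mul wM linearZ.
have : 0 < dotv w^T w^T.
  by rewrite lt0r dotv_ge0 dotv_eq0 trmx_eq0 w0.
move=> /pmulr_lge0 <-.
by rewrite -dotvZr -vM dotv_gram dotv_ge0.
Qed.

(** The bound for A^T is deduced from the one for A by expanding
|lmax s - A v|^2 >= 0 with v = A^T s, which spares the study of the spectrum
of A A^T. *)
Lemma max_eigenvalue_bound lmax (s : 'cV[R]_m) :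
  max_eigenvalue M lmax -> 0 < lmax ->
  dotv (A^T *m s) (A^T *m s) <= lmax * dotv s s.
Proof.
move=> [_ maxP] l0; set v := A^T *m s.
have Av_le : dotv (A *m v) (A *m v) <= lmax * dotv v v.
  have [c [a [c_eig a_ge0 cE]]] := spectral_measure v gram_sym.
  rewrite -dotv_gram (cE 1%N) (cE 0%N) mulr_sumr.
  by apply: ler_sum => i _; rewrite expr0 mul1r expr1 ler_wpM2r // maxP.
have := dotv_ge0 (lmax *: s - A *m v).
have sAv : dotv s (A *m v) = dotv v v by rewrite dotv_mulmxr.
rewrite !dotv_linE (dotvC _ s) sAv => h.
rewrite -(ler_pM2l l0); nra.
Qed.

(** On the range of A^T A the zero eigenvalue is harmless: the second and third
moments of the spectral measure of w only see nonzero eigenvalues. *)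
Lemma min_eigenvalue_bound lmin (w : 'cV[R]_n) (e := M *m w) :
  min_nonzero_eigenvalue M lmin ->
  lmin * dotv e e <= dotv (A *m e) (A *m e).
Proof.
move=> [_ _ minP].
have [c [a [c_eig a_ge0 cE]]] := spectral_measure w gram_sym.
have -> : dotv e e = \sum_i c i ^+ 2 * a i.
  by rewrite -(cE 2%N) /= dotv_mulmxr gram_sym.
have -> : dotv (A *m e) (A *m e) = \sum_i c i ^+ 3 * a i.
  by rewrite -(cE 3%N) /= -dotv_gram [RHS]dotv_mulmxr gram_sym.
rewrite mulr_sumr; apply: ler_sum => i _.
rewrite mulrA ler_wpM2r //; have [->|ci0] := eqVneq (c i) 0.
  by rewrite !expr0n mulr0.
by rewrite [in leRHS]exprS ler_wpM2r ?sqr_ge0 // minP.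
Qed.

Lemma min_eigenvalue_gt0 lmin : min_nonzero_eigenvalue M lmin -> 0 < lmin.
Proof. by case=> /gram_eigenvalue_ge0 l0 ln0 _; rewrite lt0r ln0. Qed.

(** Errors are found in the range of A^T, while [min_eigenvalue_bound] is about
the range of A^T A; the pseudo-inverse shows that the two ranges coincide. *)
Lemma range_tr_gram (X : 'M[R]_(n, m)) (y : 'cV[R]_m) : is_pinv A X ->
  A^T *m y = M *m (X *m y).
Proof.
move=> [AXA _ AXsym _].
by rewrite mulmxA -(mulmxA A^T) -AXsym -trmx_mul AXA.
Qed.

End GramSpectrum.

Section Projection.
Context {R : realType} {n k : nat} (P : 'M[R]_(n, k)).
Hypothesis PTP : P^T *m P \in unitmx.
Local Notation Q := (col_proj P).

Lemma col_proj_sym : Q^T = Q.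
Proof. by rewrite /col_proj !trmx_mul trmxK trmx_inv trmx_mul trmxK mulmxA. Qed.

Lemma mulmx_tr_col_proj : P^T *m Q = P^T.
Proof. by rewrite /col_proj !mulmxA mulmxV // mul1mx. Qed.

Lemma col_proj_idem : Q *m Q = Q.
Proof. by rewrite {1}/col_proj -mulmxA mulmx_tr_col_proj. Qed.

Lemma col_proj_orth (e : 'cV[R]_n) : P^T *m e = 0 -> Q *m e = 0.
Proof. by rewrite /col_proj -mulmxA => ->; rewrite mulmx0. Qed.

Lemma residual_orth (v : 'cV[R]_n) : P^T *m (v - Q *m v) = 0.
Proof. by rewrite mulmxBr mulmxA mulmx_tr_col_proj subrr. Qed.

Lemma dotv_proj (v : 'cV[R]_n) : dotv (Q *m v) (Q *m v) = dotv v (Q *m v).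
Proof. by rewrite dotv_mulmxr col_proj_sym mulmxA col_proj_idem dotvC. Qed.

Lemma dotv_residual (v : 'cV[R]_n) :
  dotv (v - Q *m v) (v - Q *m v) = dotv v v - dotv (Q *m v) (Q *m v).
Proof. by rewrite !dotv_linE (dotvC (Q *m v) v) dotv_proj; ring. Qed.

Lemma dotv_residual_orth (v e : 'cV[R]_n) : P^T *m e = 0 ->
  dotv (v - Q *m v) e = dotv v e.
Proof.
move=> /col_proj_orth Qe.
rewrite dotvDl dotvNl (dotvC (Q *m v)) dotv_mulmxr col_proj_sym Qe.
by rewrite (dotvC 0) dotv0r oppr0 addr0.
Qed.

(** The quotient whose arccosine is taken lies in [0, 1], because a projection
does not increase the norm. *)
Lemma angle_cols_cos (v : 'cV[R]_n) : v != 0 ->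
  0 <= angle_cols v P <= pi / 2 /\
  cos (angle_cols v P) ^+ 2 * dotv v v = dotv (Q *m v) (Q *m v).
Proof.
move=> v0; have v_gt0 : 0 < dotv v v by rewrite lt0r dotv_eq0 v0 dotv_ge0.
have nv0 : 0 < norm2 v by rewrite sqrtr_gt0.
set c := norm2 (Q *m v) / norm2 v.
have c0 : 0 <= c by rewrite divr_ge0 ?sqrtr_ge0.
have c1 : c <= 1.
  rewrite ler_pdivrMr // mul1r ler_sqrt ?dotv_ge0 //.
  by rewrite -subr_ge0 -dotv_residual dotv_ge0.
have c11 : -1 <= c <= 1 by rewrite c1 (le_trans _ c0) // lerN10.
rewrite /angle_cols -/c; split; last first.
  by rewrite acosK ?in_itv //= -!sqr_norm2 expr_div_n divfK // sqrf_eq0 gt_eqF.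
have pihalf : 0 <= @pi R / 2 <= @pi R.
  have := pi_ge0 R; lra.
rewrite acos_ge0 //= leNgt -ltr_cos ?in_itv /= ?acos_ge0 ?acos_lepi //.
by rewrite cos_pihalf acosK ?in_itv //= -leNgt.
Qed.

End Projection.

(** * The iteration as a sequence of projections *)

Section OrthogonalDirections.
Context {R : realType} {n : nat}.
Implicit Types (ps : seq 'cV[R]_n) (p e : 'cV[R]_n).

Definition orth_dirs ps :=
  pairwise (fun u v => dotv u v == 0) ps && all (fun u => u != 0) ps.

Lemma orth_dirs_rcons ps p :
  orth_dirs (rcons ps p) =
  [&& orth_dirs ps, all (fun u => dotv u p == 0) ps & p != 0].
Proof.
rewrite /orth_dirs pairwise_rcons all_rcons.
by case: (all _ ps) (pairwise _ ps) (p != 0) (all _ ps) => [] [] [] [].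
Qed.

Lemma tr_cols_mxE ps e i : ((cols_mx ps)^T *m e) i 0 = dotv ps`_i e.
Proof. by rewrite dotvE mxE; apply: eq_bigr => j _; rewrite !mxE. Qed.

Lemma tr_cols_mx_eq0P ps e :
  reflect ((cols_mx ps)^T *m e = 0) (all (fun p => dotv p e == 0) ps).
Proof.
apply: (iffP (all_nthP 0)) => [pe|pe i ips].
  by apply/colP => i; rewrite tr_cols_mxE mxE; apply/eqP/pe.
by rewrite -(tr_cols_mxE _ (Ordinal ips)) pe mxE.
Qed.

Lemma gk_Theta_diag ps : orth_dirs ps ->
  gk_Theta ps = diag_mx (\row_j dotv ps`_j ps`_j).
Proof.
move=> /andP[/(pairwiseP 0) orth _]; apply/matrixP => i j.
have -> : gk_Theta ps i j = dotv ps`_i ps`_j.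
  by rewrite dotvE mxE; apply: eq_bigr => h _; rewrite !mxE.
rewrite !mxE; have [->|nij] := eqVneq i j; first by rewrite mulr1n.
rewrite mulr0n; apply/eqP.
have /orP[ij|ji] : (i < j)%N || (j < i)%N by rewrite -neq_ltn.
  by apply: orth => //; rewrite inE.
by rewrite dotvC; apply: orth => //; rewrite inE.
Qed.

Lemma orth_dirs_sqr_neq0 ps (j : 'I_(size ps)) : orth_dirs ps ->
  dotv ps`_j ps`_j != 0.
Proof. by move=> /andP[_ /(all_nthP 0) nz]; rewrite dotv_eq0 nz. Qed.

Lemma gk_Theta_unit ps : orth_dirs ps -> gk_Theta ps \in unitmx.
Proof.
move=> ops; rewrite gk_Theta_diag // unitmxE det_diag unitfE.
by apply/prodf_neq0 => j _; rewrite mxE orth_dirs_sqr_neq0.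
Qed.

Lemma gk_Theta_inv ps : orth_dirs ps ->
  invmx (gk_Theta ps) = diag_mx (\row_j (dotv ps`_j ps`_j)^-1).
Proof.
move=> ops; rewrite -[LHS]mulmx1.
suff <- : gk_Theta ps *m diag_mx (\row_j (dotv ps`_j ps`_j)^-1) = 1%:M.
  by rewrite mulKmx // gk_Theta_unit.
rewrite gk_Theta_diag // mulmx_diag -diag_const_mx; congr diag_mx.
by apply/rowP => j; rewrite !mxE divff // orth_dirs_sqr_neq0.
Qed.

(** Nonzero pairwise orthogonal vectors are linearly independent: Theta is an
invertible product through R^n.  This limits the number of effective draws. *)
Lemma size_orth_dirs ps : orth_dirs ps -> (size ps <= n)%N.
Proof.
move=> /gk_Theta_unit; rewrite -row_full_unit => /eqP <-.
exact: leq_trans (mxrankM_maxr _ _) (rank_leq_row _).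
Qed.

(** With d = Theta^(-1/2) P^T v, the number |d|^2 is the squared norm of the
orthogonal projection of v on the column space of P, so that the denominator
of gamma is the squared norm of the orthogonal residual. *)
Lemma gk_denomE m (A : 'M[R]_(m, n)) ps s : orth_dirs ps ->
  let u := A^T *m s - col_proj (cols_mx ps) *m (A^T *m s) in
  gk_denom A ps s = dotv u u.
Proof.
move=> ops /=; rewrite dotv_residual ?(gk_Theta_unit ops) //.
rewrite /gk_denom !sqr_norm2; congr (_ - _).
rewrite dotv_proj ?(gk_Theta_unit ops) // /gk_d -!mulmxA.
have -> : \row_j (Num.sqrt (gk_Theta ps j j))^-1 =
          \row_j (Num.sqrt (dotv ps`_j ps`_j))^-1 :> 'rV[R]_(size ps).
  by apply: eq_mx => i j; rewrite gk_Theta_diag // !mxE eqxx.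
set z := _^T *m (A^T *m s); set D := diag_mx _.
rewrite [RHS]dotv_mulmxr -/z [LHS]dotv_mulmxr /D tr_diag_mx dotvC.
congr dotv; rewrite mulmxA mulmx_diag; congr (_ *m _).
rewrite [RHS]gk_Theta_inv //; congr diag_mx; apply/rowP => j.
by rewrite !mxE -invfM -expr2 sqr_sqrtr // dotv_ge0.
Qed.

Lemma gk_directionE m (A : 'M[R]_(m, n)) b (st : @gk_state R n) s :
  gk_direction A b st s = gk_gamma A b st s *:
    (A^T *m s - col_proj (cols_mx st.2) *m (A^T *m s)).
Proof. by rewrite /gk_direction /col_proj !mulmxA. Qed.

End OrthogonalDirections.

Section Step.
Context {R : realType} {m n : nat}.
Variables (A : 'M[R]_(m, n)) (b : 'cV[R]_m).
Variables (X : 'M[R]_(n, m)) (xstar : 'cV[R]_n).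
Hypotheses (pinvX : is_pinv A X) (Axstar : A *m xstar = b).
Implicit Types (st : @gk_state R n) (t : {set 'I_m}).

(** The matrix X A is the orthogonal projector onto the range of A^T, hence the
last two clauses say that the directions and the error lie in that range. *)
Definition gk_invariant st :=
  [/\ orth_dirs st.2, all (fun p => dotv p (st.1 - xstar) == 0) st.2,
      all (fun p => X *m A *m p == p) st.2 &
      X *m A *m (st.1 - xstar) = st.1 - xstar].

Definition sqr_error st := dotv (st.1 - xstar) (st.1 - xstar).

(** The direction of the step before its scaling by gamma: the part of A^T s
orthogonal to the previous directions. *)
Definition reduced_dir st t :=
  A^T *m gk_sketch A b st t
    - col_proj (cols_mx st.2) *m (A^T *m gk_sketch A b st t).

Lemma pinv_range_tr (y : 'cV[R]_m) : X *m A *m (A^T *m y) = A^T *m y.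
Proof.
by have [AXA _ _ <-] := pinvX; rewrite mulmxA -trmx_mul mulmxA AXA.
Qed.

Lemma pinv_cols_mx ps (e : 'cV[R]_(size ps)) :
  all (fun p => X *m A *m p == p) ps ->
  X *m A *m (cols_mx ps *m e) = cols_mx ps *m e.
Proof.
move=> /(all_nthP 0) psX; rewrite mulmxA; congr (_ *m _).
apply/matrixP => i j; rewrite [RHS]mxE -[in RHS](eqP (psX j (ltn_ord j))).
by rewrite !mxE; apply: eq_bigr => h _; rewrite !mxE.
Qed.

Lemma reduced_dir_range st t : gk_invariant st ->
  X *m A *m reduced_dir st t = reduced_dir st t.
Proof.
move=> [_ _ psX _]; rewrite mulmxBr pinv_range_tr; congr (_ - _).
by rewrite /col_proj -!(mulmxA (cols_mx _)) pinv_cols_mx.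
Qed.

Lemma residual_error st : b - A *m st.1 = - (A *m (st.1 - xstar)).
Proof. by rewrite mulmxBr Axstar opprB. Qed.

Lemma gk_sketchE st t i :
  gk_sketch A b st t i 0 = if i \in t then (b - A *m st.1) i 0 else 0.
Proof.
rewrite /gk_sketch summxE (eq_bigr (fun j => if j == i then
  (b - A *m st.1) i 0 else 0)); last first.
  move=> j _; rewrite mxE [delta_mx _ _ _ _]mxE andbT eq_sym.
  by case: eqP => [->|_]; rewrite ?mulr1 ?mulr0.
rewrite -big_mkcondr /=; case: ifP => it; last first.
  by rewrite big1 // => j /andP[jt /eqP ji]; rewrite -ji jt in it.
by rewrite (bigD1 i) ?it ?eqxx //= big1 ?addr0 // => j /andP[/andP[_ ->]].
Qed.

Lemma dotv_sketch st t :
  dotv (gk_sketch A b st t) (gk_sketch A b st t) =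
  \sum_(i in t) (b - A *m st.1) i 0 ^+ 2.
Proof.
rewrite dotvE [RHS]big_mkcond; apply: eq_bigr => i _; rewrite gk_sketchE.
by case: ifP; rewrite ?mul0r.
Qed.

Lemma dotv_sketch_residual st t :
  dotv (gk_sketch A b st t) (b - A *m st.1) =
  dotv (gk_sketch A b st t) (gk_sketch A b st t).
Proof.
rewrite dotv_sketch dotvE [RHS]big_mkcond; apply: eq_bigr => i _.
by rewrite gk_sketchE; case: ifP; rewrite ?mul0r.
Qed.

(** The error is orthogonal to the previous directions, so removing their span
from A^T s does not change its product with the error. *)
Lemma reduced_dir_error st t : gk_invariant st ->
  dotv (reduced_dir st t) (st.1 - xstar) =
  - dotv (gk_sketch A b st t) (gk_sketch A b st t).
Proof.
move=> [ops perp _ _]; rewrite dotv_residual_orth; last exact/tr_cols_mx_eq0P.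
rewrite -dotv_sketch_residual residual_error dotvNr opprK.
by rewrite dotv_mulmxr.
Qed.

(** The step is defined exactly when the sketch is nonzero: if A^T s belongs to
the span of the previous directions, it is orthogonal to the error, and that
product is - |s|^2. *)
Lemma reduced_dir_eq0 st t : gk_invariant st ->
  (dotv (reduced_dir st t) (reduced_dir st t) == 0) =
  (gk_sketch A b st t == 0).
Proof.
move=> inv; rewrite dotv_eq0; apply/idP/idP => [/eqP u0|/eqP s0].
  by rewrite -dotv_eq0 -oppr_eq0 -reduced_dir_error // u0 dotvC dotv0r.
by rewrite /reduced_dir s0 !mulmx0 subrr.
Qed.

(** An effective step projects the error onto the orthogonal complement of u. *)
Lemma gk_stepE st t (u := reduced_dir st t) : gk_invariant st ->
  gk_step A b st t =
  if gk_sketch A b st t != 0 then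
    let p := - (dotv u (st.1 - xstar) / dotv u u) *: u in
    (st.1 + p, rcons st.2 p)
  else st.
Proof.
move=> inv; have [ops _ _ _] := inv.
rewrite /gk_step gk_Theta_unit //= gk_directionE gk_denomE //.
rewrite -/(reduced_dir _ _).
rewrite reduced_dir_eq0 //; case: ifP => // _.
rewrite /gk_gamma gk_denomE // dotv_sketch_residual -/(reduced_dir _ _) -/u.
by rewrite reduced_dir_error // mulNr opprK.
Qed.

Lemma gk_step_invariant st t : gk_invariant st ->
  gk_invariant (gk_step A b st t).
Proof.
move=> inv; have [ops perp psX eX] := inv.
rewrite gk_stepE //; case: ifPn => // s0 /=.
set u := reduced_dir st t; set p := _ *: u; set e := st.1 - xstar.
have uu0 : dotv u u != 0 by rewrite reduced_dir_eq0.
have ue0 : dotv u e != 0 by rewrite reduced_dir_error // oppr_eq0 dotv_eq0.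
have pu0 : all (fun q => dotv q u == 0) st.2.
  by apply/tr_cols_mx_eq0P/residual_orth/gk_Theta_unit.
split=> /=.
- rewrite orth_dirs_rcons ops /=; apply/andP; split.
    by apply: sub_all pu0 => q /eqP qu; rewrite /p dotvZr qu mulr0.
  rewrite /p scaler_eq0 oppr_eq0 mulf_eq0 invr_eq0 (negPf ue0) (negPf uu0) /=.
  by rewrite -dotv_eq0.
- rewrite (addrAC st.1) -/e all_rcons; apply/andP; split.
    by apply/eqP; rewrite /p dotvZl (dotvDr u e) dotvZr; field.
  apply/allP => q qps; rewrite dotvDr dotvZr.
  by rewrite (eqP (allP perp _ qps)) (eqP (allP pu0 _ qps)) mulr0 addr0.
- rewrite all_rcons psX andbT; apply/eqP.
  by rewrite /p -scalemxAr reduced_dir_range.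
- by rewrite addrAC /p mulmxDr eX -scalemxAr reduced_dir_range.
Qed.

Lemma sqr_error_step st t (s := gk_sketch A b st t) (u := reduced_dir st t) :
  gk_invariant st ->
  sqr_error (gk_step A b st t) = sqr_error st - dotv s s ^+ 2 / dotv u u.
Proof.
move=> inv; rewrite gk_stepE //; case: ifPn => [s0|]; last first.
  by rewrite negbK => /eqP s0; rewrite /s s0 dotv0r expr0n mul0r subr0.
have uu0 : dotv u u != 0 by rewrite reduced_dir_eq0.
rewrite -sqrrN -reduced_dir_error // -/u /sqr_error /=.
rewrite (addrAC st.1) -/u; clearbody u; move: (st.1 - xstar) => e.
by rewrite !dotv_linE (dotvC e u); field.
Qed.

Lemma sqr_error_step_le st t : gk_invariant st ->
  sqr_error (gk_step A b st t) <= sqr_error st.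
Proof.
by move=> inv; rewrite sqr_error_step // gerBl divr_ge0 ?sqr_ge0 ?dotv_ge0.
Qed.

(** The matrix A is injective on the range of A^T, which contains the error. *)
Lemma sqr_error_eq0 st : gk_invariant st ->
  (sqr_error st == 0) = (b - A *m st.1 == 0).
Proof.
move=> [_ _ _ eX]; rewrite /sqr_error dotv_eq0 residual_error oppr_eq0.
apply/eqP/eqP => [->|Ae0]; first by rewrite mulmx0.
by rewrite -eX -mulmxA Ae0 mulmx0.
Qed.

Section Run.
Variable x0 : 'cV[R]_n.
Hypothesis x0_range : X *m A *m (x0 - xstar) = x0 - xstar.
Variable t : nat -> {set 'I_m}.
Local Notation run := (gk_run A b x0 t).

Lemma gk_run_invariant k : gk_invariant (run k).
Proof. by elim: k => [|k IH]; [split | exact: gk_step_invariant]. Qed.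

Lemma sqr_error_run_nincr k j : sqr_error (run (k + j)) <= sqr_error (run k).
Proof.
elim: j => [|j IH]; first by rewrite addn0.
rewrite addnS; apply: le_trans IH.
exact: sqr_error_step_le (gk_run_invariant _).
Qed.

(** A draw that changes the state also appends a direction. *)
Lemma gk_run_stalls_or_grows k j :
  run (k + j) = run k \/
  exists k', (size (run k).2 < size (run k').2)%N.
Proof.
elim: j => [|j [IH|]]; first by rewrite addn0; left.
  rewrite addnS /= IH gk_stepE; last exact: gk_run_invariant.
  case: ifPn => s0; last by left.
  right; exists (k + j).+1.
  by rewrite /= IH gk_stepE ?s0 /= ?size_rcons //; exact: gk_run_invariant.
by right.
Qed.

(** As long as the error is nonzero, some entry of the residual is nonzero, and
the next draw of that row, if not an earlier one, is effective.  So the list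
of directions would outgrow the dimension n if the error never vanished. *)
Lemma gk_run_terminates :
  (forall i k, exists j, i \in t (k + j)) ->
  exists k, sqr_error (run k) = 0.
Proof.
move=> visits.
suff /(_ n.+1)[k [ek|sz]] : forall N, exists k,
    sqr_error (run k) = 0 \/ (N <= size (run k).2)%N.
- by exists k.
- have [ops _ _ _] := gk_run_invariant k.
  by have := leq_trans sz (size_orth_dirs ops); rewrite ltnn.
elim=> [|N [k IH]]; first by exists 0; right.
have [/eqP e0|e0] := boolP (sqr_error (run k) == 0); first by exists k; left.
case: IH => [/eqP|Nk]; first by rewrite (negPf e0).
move: e0; rewrite sqr_error_eq0 => [r0|]; last exact: gk_run_invariant.
have [i ri] : exists i, (b - A *m (run k).1) i 0 != 0.
  by apply/existsP; rewrite -negb_forall; apply: contraNN r0 => /forallP r0;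
     apply/eqP/colP => i; rewrite [RHS]mxE; apply/eqP.
have [j ij] := visits i k.
have [stall|[k' kk']] := gk_run_stalls_or_grows k j; last first.
  by exists k'; right; exact: leq_ltn_trans kk'.
exists (k + j).+1; right.
rewrite /= stall gk_stepE; last exact: gk_run_invariant.
case: ifPn => [_|]; first by rewrite size_rcons.
rewrite negbK => /eqP/colP/(_ i); rewrite gk_sketchE ij [RHS]mxE => ri0.
by rewrite ri0 eqxx in ri.
Qed.

Lemma gk_iter_cvg :
  (forall i k, exists j, i \in t (k + j)) ->
  gk_iter A b x0 t k @[k --> \oo] --> xstar.
Proof.
move=> /gk_run_terminates[k ek]; apply: cvg_near_cst.
exists k => // j /= /subnKC <-.
apply/eqP; rewrite -subr_eq0 -dotv_eq0 eq_le dotv_ge0 andbT.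
by rewrite -[X in _ <= X]ek; exact: sqr_error_run_nincr.
Qed.

End Run.
End Step.

Lemma gk_run_ext {R : realType} m n (A : 'M[R]_(m, n)) b x0
    (t t' : nat -> {set 'I_m}) k :
  (forall i, (i < k)%N -> t i = t' i) -> gk_run A b x0 t k = gk_run A b x0 t' k.
Proof.
elim: k => //= k IH tt'; rewrite tt' // IH // => i ik.
exact/tt'/ltnW.
Qed.

(** * The expected decrease over one uniform draw *)

Section Counting.
Variables (m q : nat).

(** For q > 0 the cardinal is 'C(m.-1, q.-1), the number of all draws minus that
of the draws inside the complement of i; the product form also covers q = 0. *)
Lemma card_draws_containing (i : 'I_m) :
  (m * #|[set t : {set 'I_m} | (#|t| == q) && (i \in t)]%SET|
   = q * 'C(m, q))%N.
Proof.
have : (#|[set t : {set 'I_m} | #|t| == q]%SET| = 'C(m, q))%N.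
  by rewrite card_draws card_ord.
rewrite -(cardsID [set t : {set 'I_m} | i \in t]%SET).
have -> : ([set t : {set 'I_m} | #|t| == q] :\: [set t : {set 'I_m} | i \in t]
    = [set t : {set 'I_m} | t \subset ~: [set i] & #|t| == q])%SET.
  by apply/setP => t; rewrite !inE finset.subsetC finset.sub1set inE.
rewrite cards_draws cardsC1 card_ord.
have -> : ([set t : {set 'I_m} | #|t| == q] :&: [set t : {set 'I_m} | i \in t]
    = [set t : {set 'I_m} | (#|t| == q) && (i \in t)])%SET.
  by apply/setP => t; rewrite !inE.
set c := #|_|; clearbody c; case: m i => [[] //|m' _]; case: q => [|q'].
  by rewrite !bin0 addn1 => -[->]; rewrite muln0.
move=> cE; rewrite -mul_bin_diag; congr (_ * _)%N.
by move: cE; rewrite binS addnC => /addnI.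
Qed.

Lemma exists_draw_containing (i : 'I_m) : (0 < q <= m)%N ->
  exists t : {set 'I_m}, #|t| = q /\ i \in t.
Proof.
move=> /andP[q0 qm].
have : (0 < #|[set t : {set 'I_m} | (#|t| == q) && (i \in t)]%SET|)%N.
  have : (0 < q * 'C(m, q))%N by rewrite muln_gt0 q0 bin_gt0.
  by rewrite -(card_draws_containing i) muln_gt0 => /andP[].
by rewrite card_gt0 => /set0Pn[t]; rewrite inE => /andP[/eqP]; exists t.
Qed.

(** Each index belongs to a uniform draw of q indices with probability q / m. *)
Lemma mean_sum_over_draws (R : realFieldType) (F : 'I_m -> R) :
  (q <= m)%N ->
  m%:R * \sum_(t : {set 'I_m} | #|t| == q) 'C(m, q)%:R^-1 * \sum_(i in t) F i =
  q%:R * \sum_i F i.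
Proof.
move=> qm; have C0 : 'C(m, q)%:R != 0 :> R by rewrite pnatr_eq0 -lt0n bin_gt0.
rewrite -mulr_sumr (exchange_big_dep predT) //= mulrCA !mulr_sumr.
apply: eq_bigr => i _; rewrite sumr_const -(mulr_natl (F i)).
set c := #|_|; have -> : c =
          #|[set t : {set 'I_m} | (#|t| == q) && (i \in t)]%SET|.
  by apply: eq_card => t; rewrite !inE.
set c' := #|_|; have cE : m%:R * c'%:R = q%:R * 'C(m, q)%:R :> R.
  by rewrite -!natrM card_draws_containing.
transitivity ('C(m, q)%:R^-1 * (m%:R * c'%:R) * F i); first by ring.
by rewrite cE; field.
Qed.

End Counting.

Section ExpectedStep.
Context {R : realType} {m n : nat}.
Variables (A : 'M[R]_(m, n)) (b : 'cV[R]_m).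
Variables (X : 'M[R]_(n, m)) (xstar : 'cV[R]_n).
Hypotheses (pinvX : is_pinv A X) (Axstar : A *m xstar = b).
Variables (q : nat) (st : @gk_state R n).
Hypothesis inv : gk_invariant A X xstar st.
Local Notation sketch := (gk_sketch A b st).
Local Notation u := (reduced_dir A b st).
Local Notation theta := (gk_theta A b q st).

(** The angle [gk_theta] is a maximum of angles in [0, pi / 2], where the sine
increases, and |u| = sin(a) |A^T s| for the angle a of the draw t itself. *)
Lemma reduced_dir_le_theta (t : {set 'I_m}) : #|t| = q ->
  A^T *m sketch t != 0 ->
  dotv (u t) (u t) <=
  sin theta ^+ 2 * dotv (A^T *m sketch t) (A^T *m sketch t).
Proof.
move=> tq v0; have [/gk_Theta_unit Pu _ _ _] := inv.
have angle_bounds := angle_cols_cos Pu.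
have [/andP[a0 a1] acos2] := angle_bounds _ v0.
set a := angle_cols _ _ in a0 a1 acos2.
have a_le : a <= theta by apply: le_bigmax_cond; rewrite tq eqxx.
have theta_le : theta <= pi / 2.
  apply: bigmax_le => [|t' /andP[_ /angle_bounds[/andP[]]]//].
  by rewrite divr_ge0 // pi_ge0.
have pi0 := pi_ge0 R.
have cos_le : cos theta <= cos a.
  by rewrite leNgt ltr_cos ?in_itv /= -?leNgt //; apply/andP; split; lra.
have cos0 : 0 <= cos theta by apply: cos_ge0_pihalf; apply/andP; split; lra.
rewrite dotv_residual // -acos2 sin2cos2 mulrBl mul1r lerB //.
by rewrite ler_wpM2r ?dotv_ge0 // ler_sqr ?nnegrE // (le_trans cos0).
Qed.

Variables (lmin lmax l : R).
Hypotheses (minP : min_nonzero_eigenvalue (A^T *m A) lmin)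
  (maxP : max_eigenvalue (A^T *m A) lmax).

Lemma min_le_max_eigenvalue : 0 < lmin <= lmax.
Proof.
by rewrite (min_eigenvalue_gt0 minP); case: minP maxP => ? _ _ [_]; apply.
Qed.

(** The decrease |s|^4 / |u|^2 is bounded below through
|u|^2 <= sin^2 theta |A^T s|^2 <= sin^2 theta lmax |s|^2.  When sin theta = 0
every sketch by q rows is zero, and the quotient by zero is 0 by convention. *)
Lemma sqr_error_step_theta (t : {set 'I_m}) : #|t| = q ->
  sqr_error xstar (gk_step A b st t) <=
  sqr_error xstar st - dotv (sketch t) (sketch t) / (sin theta ^+ 2 * lmax).
Proof.
move=> tq; have /andP[lmin0 lminmax] := min_le_max_eigenvalue.
have lmax0 := lt_le_trans lmin0 lminmax.
rewrite (sqr_error_step Axstar t inv) lerD2l lerN2.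
have [s0|s0] := eqVneq (sketch t) 0; first by rewrite s0 dotv0r expr0n !mul0r.
set s := sketch t in s0 *; set v := A^T *m s.
have ss0 : 0 < dotv s s by rewrite lt0r dotv_eq0 s0 dotv_ge0.
have uu0 : 0 < dotv (u t) (u t).
  by rewrite lt0r (reduced_dir_eq0 Axstar t inv) s0 dotv_ge0.
have v0 : v != 0.
  apply: contraTneq uu0 => v0; rewrite /reduced_dir -/s -/v v0.
  by rewrite mulmx0 subr0 dotv0r ltxx.
have u_le := reduced_dir_le_theta tq v0.
have v_le := max_eigenvalue_bound s maxP lmax0.
have sin0 : 0 < sin theta ^+ 2.
  have vv0 : 0 < dotv v v by rewrite lt0r dotv_eq0 v0 dotv_ge0.
  by rewrite -(pmulr_lgt0 _ vv0) (lt_le_trans uu0).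
have D0 : 0 < sin theta ^+ 2 * lmax by rewrite mulr_gt0.
rewrite ler_pdivlMr // mulrAC ler_pdivrMr // expr2 -mulrA ler_pM2l //.
apply: (le_trans u_le).
have -> : dotv s s * (sin theta ^+ 2 * lmax) =
          sin theta ^+ 2 * (lmax * dotv s s) by ring.
by rewrite ler_pM2l.
Qed.

(** The mean of |s|^2 is l |A e|^2 >= l lmin |e|^2.  The argument gives the ratio
lmin / lmax; its square is reached by the last estimate, which weakens the
bound by one more factor lmin / lmax <= 1. *)
Lemma expected_sqr_error_step : 0 <= l < 1 -> q%:R = l * m%:R ->
  \sum_(t : {set 'I_m} | #|t| == q)
     'C(m, q)%:R^-1 * sqr_error xstar (gk_step A b st t) <=
  (1 - l * lmin ^+ 2 / (sin theta ^+ 2 * lmax ^+ 2)) * sqr_error xstar st.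
Proof.
move=> /andP[l0 l1] ql; have /andP[lmin0 lminmax] := min_le_max_eigenvalue.
have lmax0 := lt_le_trans lmin0 lminmax.
have qm : (q <= m)%N by rewrite -(ler_nat R) ql ler_piMl // ltW.
have C0 : 0 < 'C(m, q)%:R :> R by rewrite ltr0n bin_gt0.
set sigma := sin theta ^+ 2; have sigma0 : 0 <= sigma by rewrite sqr_ge0.
set E := sqr_error xstar st; pose r := b - A *m st.1.
have mean_s : \sum_(t : {set 'I_m} | #|t| == q)
    'C(m, q)%:R^-1 * dotv (sketch t) (sketch t) = l * dotv r r.
  under eq_bigr do rewrite dotv_sketch.
  have rE : dotv r r = \sum_i r i 0 ^+ 2.
    by rewrite dotvE; apply: eq_bigr => i _; rewrite expr2.
  have := mean_sum_over_draws (fun i => r i 0 ^+ 2) qm.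
  rewrite ql -rE -mulrA mulrCA; case: (posnP m) => [m0 _|m0].
    have noI (i : 'I_m) : False.
      by have := leq_trans (ltn_ord i) (eq_leq m0).
    rewrite rE [X in _ = l * X]big1; last by move=> i; case: (noI i).
    by rewrite mulr0 big1 // => t _; rewrite big1 ?mulr0 // => i; case: (noI i).
  by move=> /mulfI; apply; rewrite pnatr_eq0 -lt0n.
have r_ge : lmin * E <= dotv r r.
  have [_ _ _ eX] := inv; have [_ _ _ XAsym] := pinvX.
  rewrite /r (residual_error Axstar) dotvNr dotvNl opprK.
  rewrite /E /sqr_error -eX -XAsym trmx_mul -mulmxA (range_tr_gram _ pinvX).
  exact: min_eigenvalue_bound.
have le_mean : \sum_(t : {set 'I_m} | #|t| == q)
     'C(m, q)%:R^-1 * sqr_error xstar (gk_step A b st t) <=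
   E - l * dotv r r / (sigma * lmax).
  rewrite -mean_s.
  have -> : E = \sum_(t : {set 'I_m} | #|t| == q) 'C(m, q)%:R^-1 * E.
    rewrite sumr_const -(mulr_natl (_ * E)).
    set c := #|_|; have -> : c =
       #|[set t : {set 'I_m} | #|t| == q]%SET|.
      by apply: eq_card => t; rewrite !inE.
    by rewrite card_draws card_ord mulrA divff ?mul1r // gt_eqF.
  rewrite mulr_suml -sumrB; apply: ler_sum => t /eqP tq.
  rewrite -mulrA -mulrBr ler_wpM2l ?invr_ge0 ?(ltW C0) //.
  exact: sqr_error_step_theta.
apply: (le_trans le_mean); rewrite mulrBl mul1r lerB //.
have -> : l * lmin ^+ 2 / (sigma * lmax ^+ 2) * E =
  l * (lmin * E) / (sigma * lmax) * (lmin / lmax).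
  by rewrite !invfM; ring.
have D0 : 0 <= (sigma * lmax)^-1 by rewrite invr_ge0 mulr_ge0 // ltW.
rewrite -[leRHS]mulr1; apply: ler_pM.
- have E0 : 0 <= E by exact: dotv_ge0.
  by rewrite mulr_ge0 // !mulr_ge0 // ltW.
- by rewrite divr_ge0 // ltW.
- by rewrite ler_wpM2r // ler_wpM2l.
- by rewrite ler_pdivrMr // mul1r.
Qed.

End ExpectedStep.

(** * Independent uniform draws *)

Section Sampling.
Context {R : realType} {d : measure_display} {T : measurableType d}.
Variables (P : probability T R) (m q : nat) (tau : nat -> T -> {set 'I_m}).
Hypothesis sampling : simple_random_samples P q tau.
Local Notation weight t := (if #|t| == q then ('C(m, q)%:R)^-1 else 0 : R).

Lemma measurable_draw i t : measurable [set w | tau i w = t].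
Proof. by have [mtau _ _] := sampling. Qed.

Lemma measurable_history k t : measurable (history tau k t).
Proof.
have -> : history tau k t = \bigcap_(i in `I_k) [set w | tau i w = t i].
  by apply/seteqP; split=> w /= H i; [exact: H | move=> ?; exact: H].
by apply: bigcap_measurableType => i _; exact: measurable_draw.
Qed.

(** The intersection is again a cylinder of the independent family. *)
Lemma history_next k t s :
  P ([set w | tau k w = s] `&` history tau k t) =
  (P (history tau k t) * (weight s)%:E)%E.
Proof.
have [_ Ptau indep] := sampling.
pose B i : {set {set 'I_m}} := [set if (i < k)%N then t i else s]%SET.
have BE i : [set w | tau i w \in B i] =
    [set w | tau i w = if (i < k)%N then t i else s].
  by apply/seteqP; split=> w /=; rewrite finset.in_set1 => /eqP.
have -> : [set w | tau k w = s] `&` history tau k t =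
          [set w | forall i, i \in index_iota 0 k.+1 -> tau i w \in B i].
  apply/seteqP; split=> w /=.
    move=> [ws wt] i; rewrite mem_index_iota ltnS /= finset.in_set1 => ik.
    have [/wt->//|ki] := ltnP i k.
    have -> : i = k by apply/eqP; rewrite eqn_leq ik.
    by rewrite ws.
  move=> H; split=> [|i ik]; [have := H k | have := H i].
    by rewrite mem_index_iota ltnS leqnn finset.in_set1 ltnn => /(_ isT)/eqP.
  by rewrite mem_index_iota ltnS (ltnW ik) finset.in_set1 ik => /(_ isT)/eqP.
have -> : history tau k t =
          [set w | forall i, i \in index_iota 0 k -> tau i w \in B i].
  apply/seteqP; split=> w /= H i; last first.
    move=> ik; have := H i.
    by rewrite mem_index_iota ik finset.in_set1 ik => /(_ isT)/eqP.
  by rewrite mem_index_iota /= finset.in_set1 => ik; rewrite ik H.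
rewrite !indep ?iota_uniq // big_nat_recr //=; congr (_ * _)%E.
by rewrite BE ltnn Ptau.
Qed.

(** On a history the integrand is a finite combination of indicators of the
values of the next draw. *)
Lemma cond_expect_next k t (X : T -> R) (f : {set 'I_m} -> R) :
  (0 < P (history tau k t))%E -> (forall s, 0 <= f s) ->
  (forall w, history tau k t w -> X w = f (tau k w)) ->
  cond_expect P X (history tau k t) =
  \sum_(s : {set 'I_m} | #|s| == q) 'C(m, q)%:R^-1 * f s.
Proof.
move=> H0 f0 Xf; set H := history tau k t in H0 Xf *.
have mH : measurable H := measurable_history _ _.
have PH : P H = (fine (P H))%:E by rewrite fineK // fin_num_measure.
have PH0 : fine (P H) != 0.
  by apply: contraTneq H0 => PH0; rewrite PH PH0 ltxx.
rewrite /cond_expect /Rintegral.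
have -> : (\int[P]_(w in H) (X w)%:E =
  \sum_(s : {set 'I_m}) (fine (P H) * (weight s * f s))%:E)%E.
  transitivity (\int[P]_(w in H) \sum_(s <- enum {set 'I_m})
      ((f s)%:E * (\1_[set w | tau k w = s] w)%:E))%E.
    apply: eq_integral => w; rewrite inE => Hw; rewrite Xf // big_enum /=.
    rewrite (bigD1 (tau k w)) //= indicE mem_set // mule1 big1 ?adde0 //.
    move=> s sw; rewrite indicE memNset ?mule0 //= => ws.
    by rewrite ws eqxx in sw.
  rewrite ge0_integral_sum //; last 2 first.
  - move=> s; apply: emeasurable_funM => //; apply/measurable_EFinP.
    by apply: measurable_indic; exact: measurable_draw.
  - by move=> s w _; rewrite mule_ge0 ?lee_fin.
  rewrite big_enum /=; apply: eq_bigr => s _.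
  rewrite ge0_integralZl_EFin //; last first.
    apply/measurable_EFinP.
    by apply: measurable_indic; exact: measurable_draw.
  rewrite integral_indic //; last exact: measurable_draw.
  rewrite [X in (_ * X)%E](history_next k t s) -/H {1}PH -!EFinM.
  by congr (_%:E); rewrite [RHS]mulrA [RHS]mulrC.
rewrite sumEFin /= -mulr_sumr mulrAC divff // mul1r.
rewrite [RHS]big_mkcond; apply: eq_bigr => s _.
by case: ifP => _; rewrite ?mul0r.
Qed.

(** Avoiding t0 during M draws has probability rho ^ M, where rho < 1 is the
probability of avoiding it once. *)
Lemma avoid_draw_negligible k (t0 : {set 'I_m}) : #|t0| = q -> (q <= m)%N ->
  P.-negligible [set w | forall j, tau (k + j) w != t0].
Proof.
move=> t0q qm; have [_ Ptau indep] := sampling.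
set N := [set w | _].
have mNt0 i : measurable [set w | tau i w != t0].
  have -> : [set w | tau i w != t0] = ~` [set w | tau i w = t0].
    by apply/seteqP; split=> w /= /eqP.
  exact/measurableC/measurable_draw.
have mN : measurable N.
  have -> : N = \bigcap_j [set w | tau (k + j)%N w != t0].
    by apply/seteqP; split=> w /= H j; [move=> _|]; exact: H.
  exact: bigcap_measurableType.
apply/negligibleP => //.
pose rho : R := 1 - 'C(m, q)%:R^-1.
have C0 : 0 < 'C(m, q)%:R^-1 :> R by rewrite invr_gt0 ltr0n bin_gt0.
have C1 : 'C(m, q)%:R^-1 <= 1 :> R.
  by rewrite invf_le1 ?ler1n ?ltr0n bin_gt0.
have Pavoid i : P [set w | tau i w != t0] = rho%:E.
  have -> : [set w | tau i w != t0] = ~` [set w | tau i w = t0].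
    by apply/seteqP; split=> w /= /eqP.
  by rewrite probability_setC ?Ptau ?t0q ?eqxx //; exact: measurable_draw.
have PN_le M : (P N <= (rho ^+ M)%:E)%E.
  pose B (i : nat) : {set {set 'I_m}} := (~: [set t0])%SET.
  have NB : N `<=` [set w | forall i, i \in iota k M -> tau i w \in B i].
    move=> w Nw i; rewrite mem_iota => /andP[/subnKC <- _].
    by rewrite finset.in_setC finset.in_set1.
  have BE i : [set w | tau i w \in B i] = [set w | tau i w != t0].
    by apply/seteqP; split=> w /=; rewrite finset.in_setC finset.in_set1.
  have -> : ((rho ^+ M)%:E =
      P [set w | forall i, i \in iota k M -> tau i w \in B i])%E.
    rewrite indep ?iota_uniq // (eq_bigr (fun=> rho%:E)); last first.
      by move=> i _; rewrite BE.
    elim: M k {N mN NB} => [|M IH] k'; first by rewrite big_nil.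
    by rewrite /= big_cons -IH exprS EFinM.
  apply: le_measure => //; rewrite inE //.
  have -> : [set w | forall i, i \in iota k M -> tau i w \in B i] =
     \bigcap_(i in [set i | i \in iota k M]) [set w | tau i w != t0].
    apply/seteqP; split=> w /= H i iM; have := H i iM;
      by rewrite finset.in_setC finset.in_set1.
  by apply: bigcap_measurableType => i _.
have rho_lt1 : `|rho| < 1 by rewrite ger0_norm /rho; lra.
have PNfin : P N = (fine (P N))%:E by rewrite fineK // fin_num_measure.
have : fine (P N) <= 0.
  apply: (cvgr_to_ge (cvg_expr rho_lt1)).
  by apply: nearW => M; have := PN_le M; rewrite {1}PNfin lee_fin.
rewrite -lee_fin -PNfin => PN0; apply/eqP; rewrite eq_le measure_ge0 andbT.
exact: PN0.
Qed.

(** Some fixed set of q rows that contains i recurs almost surely. *)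
Lemma ae_every_row_recurs : (0 < m -> 0 < q <= m)%N ->
  {ae P, forall w, forall (i : 'I_m) k, exists j, i \in tau (k + j) w}.
Proof.
move=> q_bounds; apply: filter_forall => i; apply: ae_foralln => k.
have qm : (0 < q <= m)%N by apply: q_bounds; exact: leq_ltn_trans (ltn_ord i).
have [t0 [t0q it0]] := exists_draw_containing i qm.
have /andP[_ qm'] := qm.
apply: negligibleS (avoid_draw_negligible k t0q qm') => w /= H j.
by apply: contra_notN H => /eqP wj; exists j; rewrite wj.
Qed.

End Sampling.

(** * Convergence and rate *)

Theorem theorem2p7 (R : realType) (m n : nat)
    (A : 'M[R]_(m, n)) (b : 'cV[R]_m) (Adag : 'M[R]_(n, m))
    (l : R) (q : nat) (x0 : 'cV[R]_n)
    (d : measure_display) (T : measurableType d) (P : probability T R)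
    (tau : nat -> T -> {set 'I_m})
    (consistent : exists x : 'cV[R]_n, A *m x = b)
    (pinvA : is_pinv A Adag)
    (l01 : 0 < l < 1) (ql : q%:R = l * m%:R)
    (x0_range : exists y : 'cV[R]_m, x0 = A^T *m y)
    (sampling : simple_random_samples P q tau) :
  let xstar := Adag *m b in
  {ae P, forall w, gk_iter A b x0 (tau ^~ w) k @[k --> \oo] --> xstar} /\
  (forall lmin lmax : R,
     min_nonzero_eigenvalue (A^T *m A) lmin ->
     max_eigenvalue (A^T *m A) lmax ->
     forall (k : nat) (t : nat -> {set 'I_m}),
     (0 < P (history tau k t))%E ->
     cond_expect P
       (fun w => norm2 (gk_iter A b x0 (tau ^~ w) k.+1 - xstar) ^+ 2)
       (history tau k t)
     <= (1 - l * lmin ^+ 2 /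
             (sin (gk_theta A b q (gk_run A b x0 t k)) ^+ 2 * lmax ^+ 2))
        * norm2 (gk_iter A b x0 t k - xstar) ^+ 2).
Proof.
move=> xstar; have [AXA XAX _ _] := pinvA.
have Axstar : A *m xstar = b.
  by rewrite /xstar; case: consistent => x <-; rewrite !mulmxA AXA.
have x0X : Adag *m A *m (x0 - xstar) = x0 - xstar.
  case: x0_range => y ->; rewrite mulmxBr (pinv_range_tr pinvA) /xstar.
  by rewrite (mulmxA (Adag *m A)) XAX.
have /andP[l0 l1] := l01.
have qm : (q <= m)%N by rewrite -(ler_nat R) ql ler_piMl // ltW.
split.
  have q_bounds : (0 < m)%N -> (0 < q <= m)%N.
    by move=> m0; rewrite qm andbT -(ltr_nat R) ql mulr_gt0 // ltr0n.
  apply: filterS (ae_every_row_recurs sampling q_bounds) => w visits.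
  exact: (gk_iter_cvg pinvA Axstar x0X).
move=> lmin lmax minP maxP k t H0.
rewrite (cond_expect_next sampling (f := fun s =>
  sqr_error xstar (gk_step A b (gk_run A b x0 t k) s))) //; last 2 first.
- by move=> s; exact: dotv_ge0.
- move=> w Hw; rewrite sqr_norm2 /gk_iter /=.
  by rewrite (gk_run_ext A b x0 (t' := t)).
rewrite sqr_norm2; apply: (expected_sqr_error_step pinvA Axstar) => //.
- exact: (gk_run_invariant pinvA Axstar x0X).
- by rewrite (ltW l0) l1.
Qed.
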